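(* Let $\mu$ be a probability measure on $\mathbb{R}$ such that $m_1(\mu)=0$, $m_2(\mu)=1$ and $m_6(\mu)<\infty$. For each positive integer $n$ define $\mu_n:=D_{\frac{1}{\sqrt{n}}}\mu^{\uplus n}$. Then there is a constant $C$ depending only on $\mu$ such that for all sufficiently large $n$, $$d_{lev}(\mu_n,\mathbf{b})\leq \frac{7}{2}\,\frac{C+2}{\sqrt{n}},$$ where $\mathbf{b}=\frac{1}{2}\delta_{-1}+\frac{1}{2}\delta_{1}$ is the symmetric Bernoulli distribution.
   Context: $m_k(\mu)=\int t^k\,d\mu(t)$ denotes the $k$-th moment. For a non-negative Borel measure $\mu$ on $\mathbb{R}$, its Cauchy transform is $G_\mu(z)=\int_{\mathbb{R}}\frac{1}{z-t}\,d\mu(t)$ for $z$ in the open upper half-plane $\mathbb{C}^+$, and its reciprocal Cauchy transform is $F_\mu(z)=1/G_\mu(z)$. The Boolean convolution $\mu\uplus\nu$ of probability measures $\mu,\nu$ is the probability measure determined by $F_{\mu\uplus\nu}(z)=F_\mu(z)+F_\nu(z)-z$ for $z\in\mathbb{C}^+$, and $\mu^{\uplus n}$ is the $n$-fold Boolean convolution of $\mu$ with itself. For $a>0$, the dilation $D_a\mu$ is defined by $D_a\mu(B)=\mu(a^{-1}B)$ for Borel sets $B$. The Lévy distance between probability measures $\mu,\nu$ with distribution functions $F,G$ is $d_{lev}(\mu,\nu)=\inf\{\epsilon>0: F(x-\epsilon)-\epsilon\le G(x)\le F(x+\epsilon)+\epsilon \text{ for all } x\in\mathbb{R}\}$. 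*)

(* Defs.v *)
From mathcomp Require Import all_boot all_order all_algebra.
From mathcomp Require Import all_classical all_reals all_analysis.
From mathcomp Require Import complex.
Set Implicit Arguments. Unset Strict Implicit. Unset Printing Implicit Defensive.
Import Order.TTheory GRing.Theory Num.Theory.
Local Open Scope classical_set_scope.
Local Open Scope ring_scope.

Section Defs.
Variable R : realType.

(* Cauchy transform G_mu(z) = int 1/(z - t) dmu(t), written through its real
   and imaginary parts: for z = x + i y,
   1/(z - t) = (x - t)/((x-t)^2+y^2) - i y/((x-t)^2+y^2). *)
Definition cauchy_transform (mu : probability R R) (z : R[i]) : R[i] :=
  let x := complex.Re z in let y := complex.Im z in
  Complex (Rintegral mu setT (fun t => (x - t) / ((x - t) ^+ 2 + y ^+ 2)))
          (- Rintegral mu setT (fun t => y / ((x - t) ^+ 2 + y ^+ 2))).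

Definition rcauchy_transform (mu : probability R R) (z : R[i]) : R[i] :=
  (cauchy_transform mu z)^-1.

Definition is_boolean_conv (mu nu rho : probability R R) : Prop :=
  forall z : R[i], 0 < complex.Im z ->
    rcauchy_transform rho z = rcauchy_transform mu z + rcauchy_transform nu z - z.

Inductive boolean_pow (mu : probability R R) : nat -> probability R R -> Prop :=
  | boolean_pow1 : boolean_pow mu 1 mu
  | boolean_powS n nu rho :
      boolean_pow mu n nu -> is_boolean_conv nu mu rho -> boolean_pow mu n.+1 rho.

Definition dilate (a : R) (m : set R -> \bar R) : set R -> \bar R :=
  fun B => m ((fun x => a * x) @^-1` B).

Definition distr_fun (m : set R -> \bar R) (x : R) : R :=
  fine (m [set t | t <= x]).

Definition levy_dist (m1 m2 : set R -> \bar R) : R :=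
  inf [set eps : R | 0 < eps /\ forall x : R,
        distr_fun m1 (x - eps) - eps <= distr_fun m2 x /\
        distr_fun m2 x <= distr_fun m1 (x + eps) + eps].

Definition bernoulli_sym : set R -> \bar R :=
  fun B => ((2^-1)%:E * @dirac _ R (-1)%R R B + (2^-1)%:E * @dirac _ R 1%R R B)%E.

End Defs.

(* Main.v *)
(** Since F_nu(z) = n F_mu(z) - (n - 1) z for nu the n-th Boolean power of mu,
    the expansion G_mu(z) = 1/z + 1/z^3 + m_3/z^4 + O(z^-5) on Im z = 1 gives
    F_nu(z) = 2 i + O(1 / sqrt n) at the two points
    z = +- sqrt n + m_3 / 2 + i. Hence the Poisson integral
    - Im G_nu(z) = \int dnu(t) / ((Re z - t)^2 + 1) is at least
    1/2 - O(1 / sqrt n) at both points. The two Poisson kernels have maximum 1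
    and hardly overlap, so nu must put mass at least 1/2 - O(1 / sqrt n) within
    distance 1 of each of the points +- sqrt n + m_3 / 2. After dilation by
    1 / sqrt n these are neighbourhoods of +-1 of radius O(1 / sqrt n). *)

Require Import Defs.
From mathcomp Require Import all_boot all_order all_algebra.
From mathcomp Require Import all_classical all_reals all_analysis.
From mathcomp Require Import measurable_realfun complex ring lra.
Set Implicit Arguments. Unset Strict Implicit. Unset Printing Implicit Defensive.
Import Order.TTheory GRing.Theory Num.Theory.
Import numFieldNormedType.Exports.
Import ComplexField.Normc.
Local Open Scope classical_set_scope.
Local Open Scope ring_scope.

(** * Reciprocal Cauchy transforms of Boolean powers *)

Lemma boolean_pow_rcauchy (R : realType) (mu nu : probability R R) n (z : R[i]) :
  boolean_pow mu n nu -> 0 < complex.Im z ->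
  rcauchy_transform nu z = n%:R * rcauchy_transform mu z - (n%:R - 1) * z.
Proof.
move=> + z0; elim=> [|k {}nu rho _ IH conv].
  by rewrite mul1r subrr mul0r subr0.
by rewrite conv// IH -natr1; ring.
Qed.

(* Here s = +- sqrt n, H5 is \int t^5 / (z - t) dmu, and the inverted factor is
   G_mu(z); since s v = 1 - w v, the terms of order s cancel. *)
Lemma boolean_pow_expansion (F : fieldType) (s w z v m3 m4 H5 : F) :
  z = s + w -> v = z^-1 -> z != 0 ->
  let H3 := v * (m3 + v * (m4 + H5)) in
  1 + v ^+ 2 * (1 + H3) != 0 ->
  s ^+ 2 * (v * (1 + v ^+ 2 * (1 + H3)))^-1 - (s ^+ 2 - 1) * z =
  2 * w - m3 + v * (- w ^+ 2 + m3 * (2 * w - w ^+ 2 * v)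
     - (1 - w * v) ^+ 2 * (m4 + H5)
     + (1 - w * v) ^+ 2 * (1 + H3) ^+ 2 / (1 + v ^+ 2 * (1 + H3))).
Proof.
move=> zE vE z0 H3 d0.
have v0 : v != 0 by rewrite vE invr_neq0.
have zv : z = v^-1 by rewrite vE invrK.
have -> : s = v^-1 - w by rewrite -zv zE addrK.
rewrite zv; move: d0; rewrite /H3 => d0.
by field; rewrite v0 d0.
Qed.

(** * Modulus estimates for complex numbers *)

Lemma normc_ge0 (R : rcfType) (x : R[i]) : 0 <= normc x.
Proof. by case: x => a b; rewrite sqrtr_ge0. Qed.

Lemma normcX (R : rcfType) (x : R[i]) n : normc (x ^+ n) = normc x ^+ n.
Proof.
elim: n => [|n IH]; first by rewrite !expr0 normc1.
by rewrite !exprS normcM IH.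
Qed.

Lemma normc_real (R : rcfType) (x : R) : normc (x%:C)%C = `|x|.
Proof. by rewrite /normc /= expr0n addr0 sqrtr_sqr. Qed.

Lemma normcD (R : rcfType) (x y : R[i]) : normc (x + y) <= normc x + normc y.
Proof. exact: le_normcD. Qed.

Lemma normc_opp (R : rcfType) (x : R[i]) : normc (- x) = normc x.
Proof. exact: normcN. Qed.

Lemma normcB (R : rcfType) (x y : R[i]) : normc (x - y) <= normc x + normc y.
Proof. by rewrite -(normc_opp y) normcD. Qed.

Lemma normcB_ge (R : rcfType) (x y : R[i]) : normc x - normc y <= normc (x + y).
Proof. by have := normcB (x + y) y; rewrite addrK lerBlDr. Qed.

Lemma normc_Im (R : rcfType) (x : R[i]) : `|complex.Im x| <= normc x.
Proof.
case: x => a b /=; rewrite -sqrtr_sqr ler_sqrt ?lerDr ?sqr_ge0//.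
by rewrite addr_ge0 ?sqr_ge0.
Qed.

Lemma normc_le (R : rcfType) (x : R[i]) :
  normc x <= `|complex.Re x| + `|complex.Im x|.
Proof.
rewrite [x in normc x]complexE; apply: le_trans (normcD _ _) _.
rewrite normcM !normc_real lerD2l.
by rewrite /normc expr0n expr1n add0r sqrtr1 mul1r.
Qed.

(** Controls the factor of [v] in [boolean_pow_expansion]. The smallness of [v] gives
    [|1 - w v| <= 2], [|1 + H3| <= 1 + M + A] and [|d| >= 1 / 2]; the coefficient 8 is [2 ^ 2]
    divided by [1 / 2]. *)
Lemma remainder_bound (R : rcfType) (v w m3 m4 H5 : R[i]) (W M A : R) :
  normc w <= W -> normc v <= 1 -> normc v * W <= 1 -> normc m3 <= M ->
  normc (m4 + H5) <= A ->
  normc v * (1 + M + A) <= 1 / 2 ->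
  let H3 := v * (m3 + v * (m4 + H5)) in
  let d := 1 + v ^+ 2 * (1 + H3) in
  d != 0 /\
  normc (- w ^+ 2 + m3 * (2 * w - w ^+ 2 * v) - (1 - w * v) ^+ 2 * (m4 + H5)
     + (1 - w * v) ^+ 2 * (1 + H3) ^+ 2 / d)
  <= W ^+ 2 + 3 * M * W + 4 * A + 8 * (1 + M + A) ^+ 2.
Proof.
move=> hw v1 vW hm hA vB H3 d.
have NM := @normcM R.
have v0 := normc_ge0 v; have w0 := normc_ge0 w; have m0 := normc_ge0 m3.
have a0 := normc_ge0 (m4 + H5).
have hwv : normc (w * v) <= 1 by rewrite NM; nra.
have h1 : normc (1 - w * v) ^+ 2 <= 4.
  have := normcB 1 (w * v); rewrite normc1.
  have := normc_ge0 (1 - w * v); nra.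
have hH3 : normc (1 + H3) <= 1 + M + A.
  have := normcD 1 H3; rewrite normc1.
  have : normc H3 <= M + A.
    rewrite /H3 NM; have := normcD m3 (v * (m4 + H5)).
    have := normc_ge0 (m3 + v * (m4 + H5)); rewrite NM; nra.
  lra.
have H30 := normc_ge0 (1 + H3).
have hd : 1 / 2 <= normc d.
  have := normcB_ge 1 (v ^+ 2 * (1 + H3)).
  rewrite normc1 NM normcX -/d.
  have : normc v ^+ 2 * normc (1 + H3) <= 1 / 2 by nra.
  lra.
split; first by apply: contraTneq hd => ->; rewrite normc0; lra.
have hq1 : normc (- w ^+ 2) <= W ^+ 2 by rewrite normc_opp normcX; nra.
have hq2 : normc (m3 * (2 * w - w ^+ 2 * v)) <= 3 * M * W.
  have e2 : normc (2 * w - w ^+ 2 * v) <= 3 * W.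
    have := normcB (2 * w) (w ^+ 2 * v); rewrite (NM 2) (NM (w ^+ 2)) normcX.
    have -> : normc (2 : R[i]) = 2 by rewrite [LHS](normcMn 1 2) normc1.
    by move: hwv; rewrite NM; nra.
  by rewrite NM; have := normc_ge0 (2 * w - w ^+ 2 * v); nra.
have hq3 : normc ((1 - w * v) ^+ 2 * (m4 + H5)) <= 4 * A.
  by rewrite NM normcX; nra.
have hq4 : normc ((1 - w * v) ^+ 2 * (1 + H3) ^+ 2 / d) <= 8 * (1 + M + A) ^+ 2.
  rewrite NM normcV ler_pdivrMr ?NM; last lra.
  have hs : normc (1 + H3) ^+ 2 <= (1 + M + A) ^+ 2 by nra.
  have : 0 <= normc (1 - w * v) ^+ 2 by exact: sqr_ge0.
  have : 0 <= normc (1 + H3) ^+ 2 by exact: sqr_ge0.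
  nra.
apply: le_trans (normcD _ _) _; apply: lerD => //.
apply: le_trans (normcB _ _) _; apply: lerD => //.
by apply: le_trans (normcD _ _) _; apply: lerD.
Qed.

(** With [j = 2i], the difference of [1 / (j + e)] and [1 / j] is [e / (j (j + e))] up to sign,
    where [|j| = 2] and [|j + e| >= 1]; and [1 / j] has imaginary part [- 1 / 2]. *)
Lemma Im_inv_near_2i (R : rcfType) (e : R[i]) :
  normc e <= 1 -> 1 / 2 - normc e <= - complex.Im (((0 +i* 2)%C + e)^-1).
Proof.
move=> e1; set j : R[i] := (0 +i* 2)%C.
have NM := @normcM R.
have Nj : normc j = 2.
  by rewrite /j /normc expr0n add0r sqrtr_sqr normr_nat.
have hje : 1 <= normc (j + e) by have := normcB_ge j e; rewrite Nj; lra.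
have j0 : j != 0 by rewrite eq_complex /= pnatr_eq0 andbF.
have je0 : j + e != 0.
  by apply: contraTneq hje => ->; rewrite normc0; lra.
have E : (j + e)^-1 = j^-1 - e / (j * (j + e)) by field; rewrite j0 je0.
have Imj : complex.Im j^-1 = - (1 / 2).
  by rewrite /= expr0n add0r; field.
have h : `|complex.Im (e / (j * (j + e)))| <= normc e.
  apply: le_trans (normc_Im _) _.
  rewrite NM normcV ler_pdivrMr NM Nj; last lra.
  by have := normc_ge0 e; nra.
rewrite E; move: Imj h; case: (j^-1) => a b; case: (e / _) => c d /= ->.
rewrite ler_norml; lra.
Qed.

(** * Moments weighted by the Cauchy kernel on the line Im z = 1 *)

Section cauchy_moments.
Variables (R : realType) (mu : probability R R).
Implicit Types (f g : R -> R) (x t : R).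

Lemma integrable_lower_moment m k : (k <= m)%N ->
  mu.-integrable setT (fun t => (t ^+ m)%:E) ->
  mu.-integrable setT (fun t => (t ^+ k)%:E).
Proof.
move=> km im.
have ig : mu.-integrable setT (EFin \o (fun t => 1 + `|t ^+ m|)).
  rewrite (_ : _ \o _ = (EFin \o cst 1) \+ (fun t => `|(t ^+ m)%:E|%E)) //.
  apply: integrableD => //; first exact: finite_measure_integrable_cst.
  exact: integrable_abse.
apply: (le_integrable _ _ _ ig) => //.
  by apply/measurable_EFinP; exact: exprn_measurable.
move=> t _; rewrite lee_fin (ger0_norm (_ : 0 <= 1 + _)) ?addr_ge0// !normrX.
have [t1|/ltW t1] := leP `|t| 1.
  by rewrite (le_trans (exprn_ile1 _ _ t1))// lerDl exprn_ge0.
by rewrite (le_trans (ler_weXn2l t1 km))// lerDr.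
Qed.

Lemma integrable_mul_bounded f g : measurable_fun setT f ->
  (forall t, `|f t| <= 1) -> mu.-integrable setT (EFin \o g) ->
  mu.-integrable setT (fun t => (g t * f t)%:E).
Proof.
move=> mf f1 ig; apply: (le_integrable _ _ _ ig) => //.
  apply/measurable_EFinP; apply: measurable_funM => //.
  by case/integrableP : ig => /measurable_EFinP.
by move=> t _; rewrite lee_fin normrM ler_piMr.
Qed.

Lemma cauchy_denom_gt0 x t : 0 < (x - t) ^+ 2 + 1.
Proof. by rewrite ltr_wpDl ?sqr_ge0. Qed.

(** Real part and negated imaginary part of [1 / (x + i - t)]; the second is the Poisson kernel at
    height 1, up to a factor pi. *)
Definition cauchy_re x t := (x - t) / ((x - t) ^+ 2 + 1).
Definition cauchy_im x t := ((x - t) ^+ 2 + 1)^-1.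

Lemma measurable_cauchy_im x : measurable_fun setT (cauchy_im x).
Proof.
apply: continuous_measurable_fun => t; apply: cvgV.
  by rewrite gt_eqF// cauchy_denom_gt0.
apply: cvgD; last exact: cvg_cst.
by apply: cvgM; apply: cvgB;
  [exact: cvg_cst|exact: cvg_id|exact: cvg_cst|exact: cvg_id].
Qed.

Lemma measurable_cauchy_re x : measurable_fun setT (cauchy_re x).
Proof.
by apply: measurable_funM; [exact: measurable_funB|exact: measurable_cauchy_im].
Qed.

Lemma cauchy_im_le1 x t : `|cauchy_im x t| <= 1.
Proof.
have h := cauchy_denom_gt0 x t.
by rewrite /cauchy_im gtr0_norm ?invr_gt0// invf_le1// lerDr sqr_ge0.
Qed.

Lemma cauchy_re_le1 x t : `|cauchy_re x t| <= 1.
Proof.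
have h := cauchy_denom_gt0 x t.
rewrite /cauchy_re normrM normfV (gtr0_norm h) ler_pdivrMr// mul1r.
rewrite -[(x - t) ^+ 2]real_normK ?num_real//.
by have := normr_ge0 (x - t); nra.
Qed.

Definition moment k : R := \int[mu]_t (t ^+ k).

(* \int t^k / (x + i - t) dmu(t), by real and imaginary parts *)
Definition cauchy_moment k x : R[i] :=
  Complex (\int[mu]_t (t ^+ k * cauchy_re x t))
          (- \int[mu]_t (t ^+ k * cauchy_im x t)).

Lemma cauchy_moment0 x : cauchy_transform mu (x +i* 1)%C = cauchy_moment 0 x.
Proof.
rewrite /cauchy_transform /cauchy_moment /=.
congr (Complex _ (- _)); apply: eq_Rintegral => t _;
  by rewrite expr0 expr1n mul1r /cauchy_im ?div1r.
Qed.

(** Integrates [z t^k / (z - t) = t^k + t^(k+1) / (z - t)] at [z = x + i]. Iterating it produces the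
    expansion of the Cauchy transform in powers of [1 / z]. *)
Lemma cauchy_momentS k x :
  mu.-integrable setT (fun t => (t ^+ k.+1)%:E) ->
  (x +i* 1)%C * cauchy_moment k x =
  ((moment k)%:C)%C + cauchy_moment k.+1 x.
Proof.
move=> iS; have ik := integrable_lower_moment (leqnSn k) iS.
have ir := integrable_mul_bounded (@measurable_cauchy_re x) (cauchy_re_le1 x).
have ii := integrable_mul_bounded (@measurable_cauchy_im x) (cauchy_im_le1 x).
have irk := ir _ ik; have iik := ii _ ik.
have irS := ir _ iS; have iiS := ii _ iS.
rewrite /moment /cauchy_moment; apply/eqP; rewrite eq_complex /=.
apply/andP; split; apply/eqP.
  rewrite mul1r opprK -RintegralZl// -!RintegralD//; last first.
    exact: (integrableZl measurableT x irk).
  apply: eq_Rintegral => t _; rewrite /cauchy_re /cauchy_im (exprS t k).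
  by field; rewrite gt_eqF// cauchy_denom_gt0.
rewrite mul1r sub0r mulrN -RintegralZl// addrC -RintegralB//; last first.
  exact: (integrableZl measurableT x iik).
rewrite -mulN1r -RintegralZl//.
apply: eq_Rintegral => t _; rewrite /cauchy_re /cauchy_im (exprS t k).
by field; rewrite gt_eqF// cauchy_denom_gt0.
Qed.

Lemma cauchy_moment_bound k x : mu.-integrable setT (fun t => (t ^+ k)%:E) ->
  normc (cauchy_moment k x) <= 2 * \int[mu]_t `|t ^+ k|.
Proof.
move=> ik.
have H f : measurable_fun setT f -> (forall t, `|f t| <= 1) ->
    `|\int[mu]_t (t ^+ k * f t)| <= \int[mu]_t `|t ^+ k|.
  move=> mf f1; have i := integrable_mul_bounded mf f1 ik.
  apply: le_trans (le_normr_Rintegral measurableT i) _.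
  apply: le_Rintegral => //; [exact: integrable_abse i|exact: integrable_abse ik|].
  by move=> t _; rewrite normrM ler_piMr.
apply: le_trans (normc_le _) _; rewrite mulr_natl mulr2n /= normrN.
by apply: lerD; apply: H; [exact: measurable_cauchy_re|exact: cauchy_re_le1|
  exact: measurable_cauchy_im|exact: cauchy_im_le1].
Qed.

End cauchy_moments.

(** * Lower bound on Poisson integrals of Boolean powers *)

(** The constants are chosen before [n], so they depend on [mu] alone. Allowing both signs of [s]
    treats the two points at once. *)
Lemma poisson_integral_boolean_pow_ge (R : realType) (mu : probability R R) :
  mu.-integrable setT (fun t : R => (t ^+ 5)%:E) ->
  moment mu 1 = 0 -> moment mu 2 = 1 ->
  exists c : R, 0 <= c /\ exists r0 : R, forall n r s nu,
    boolean_pow mu n nu -> r0 <= r -> r ^+ 2 = n%:R -> (s = r \/ s = - r) ->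
    1 / 2 - c / r <=
      \int[nu]_t ((s + moment mu 3 / 2 - t) ^+ 2 + 1)^-1.
Proof.
move=> i5 m1 m2.
have im k : (k <= 5)%N -> mu.-integrable setT (fun t : R => (t ^+ k)%:E).
  by move=> k5; exact: integrable_lower_moment k5 i5.
have m0 : moment mu 0 = 1.
  rewrite /moment; under eq_Rintegral do rewrite expr0.
  by rewrite Rintegral_cst// mul1r; exact: (congr1 fine (probability_setT mu)).
set m3 := moment mu 3; set m4 := moment mu 4.
(* The real part [m3 / 2] makes [2 * w - m3], the constant term of the expansion, exactly [2i]. *)
pose w : R[i] := (m3 / 2 +i* 1)%C.
pose W := normc w; pose M := `|m3|.
pose A := `|m4| + 2 * \int[mu]_t `|t ^+ 5|.
pose B := W ^+ 2 + 3 * M * W + 4 * A + 8 * (1 + M + A) ^+ 2.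
have W0 : 0 <= W by exact: normc_ge0.
have M0 : 0 <= M by exact: normr_ge0.
have A0 : 0 <= A by rewrite addr_ge0// mulr_ge0// Rintegral_ge0.
have B0 : 0 <= B by rewrite /B; have := sqr_ge0 W; have := sqr_ge0 (1 + M + A); nra.
(* [B] bounds the remainder and [|v| <= 2 / r], so the error is at most [2 * B / r]. *)
exists (2 * B); split; first lra.
(* The summands ensure in turn [|v| <= 1], [|z| >= r / 2] (and [|v| W <= 1]),
   [|v| (1 + M + A) <= 1 / 2], and an error of at most 1. *)
exists (2 + 2 * W + 4 * (1 + M + A) + 2 * B) => n r s nu pow hr rn hs.
have r2 : 2 <= r by lra.
have sn : (s%:C)%C ^+ 2 = n%:R :> R[i].
  rewrite -rmorphXn /=; case: hs => ->; rewrite ?sqrrN rn; exact: rmorph_nat.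
pose x := s + m3 / 2; pose z : R[i] := (x +i* 1)%C; pose v := z^-1.
have zE : z = (s%:C)%C + w by rewrite /z /w /x; simpc.
have Ns : normc (s%:C)%C = r.
  by rewrite normc_real; case: hs => ->; rewrite ?normrN ger0_norm//; lra.
have Nz : r / 2 <= normc z by have := normcB_ge (s%:C)%C w; rewrite -zE Ns -/W; lra.
have Nz0 : 0 < normc z by lra.
have z0 : z != 0.
  by apply: contraTneq Nz0 => ->; rewrite normc0 ltxx.
have Nv : normc v <= 2 / r.
  rewrite /v normcV -[2 / r]invrK invf_div lef_pV2// posrE; lra.
have Nv0 : 0 <= normc v := normc_ge0 v.
have Nvr : normc v * r <= 2 by rewrite -ler_pdivlMr//; lra.
pose H := cauchy_moment mu 5 x.
have HA : normc ((m4%:C)%C + H) <= A.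
  apply: le_trans (normcD _ _) _; rewrite normc_real lerD2l.
  exact: cauchy_moment_bound.
have hM : normc (m3%:C)%C <= M by rewrite normc_real.
have [d0 hQ] := @remainder_bound R v w (m3%:C)%C (m4%:C)%C H W M A (lexx _)
  ltac:(nra) ltac:(nra) hM HA ltac:(nra).
have G0 : cauchy_transform mu z =
    v * (1 + v ^+ 2 * (1 + v * ((m3%:C)%C + v * ((m4%:C)%C + H)))).
  have vS k y : z * cauchy_moment mu k x = y -> cauchy_moment mu k x = v * y.
    by move=> <-; rewrite mulKf.
  (* Five steps of the recursion, with the moments 1, 0, 1 inserted, leave [H] as the last
     remainder. *)
  rewrite cauchy_moment0.
  rewrite (vS _ _ (cauchy_momentS _ (im 1%N isT))) m0.
  rewrite (vS _ _ (cauchy_momentS _ (im 2%N isT))) m1.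
  rewrite (vS _ _ (cauchy_momentS _ (im 3%N isT))) m2.
  rewrite (vS _ _ (cauchy_momentS _ (im 4%N isT))).
  rewrite (vS _ _ (cauchy_momentS _ (im 5%N isT))).
  by rewrite rmorph0 rmorph1 add0r expr2 -(mulrA v v).
have zI : 0 < complex.Im z by rewrite /= ltr01.
have := boolean_pow_rcauchy pow zI.
(* Writing [n] as [s ^+ 2] brings the identity into the form of [boolean_pow_expansion]. *)
rewrite {2}/rcauchy_transform G0 -sn.
rewrite (boolean_pow_expansion (w := w) (z := z))//.
set Q := (X in _ + v * X); have {}hQ : normc Q <= B := hQ.
have -> : 2 * w - (m3%:C)%C = (0 +i* 2)%C.
  rewrite /w mulr_natl mulr2n; apply/eqP; rewrite eq_complex /=.
  apply/andP; split; apply/eqP; lra.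
move=> Fnu.
have NvQ : normc (v * Q) <= 2 * B / r.
  rewrite normcM ler_pdivlMr; last lra.
  by have := normc_ge0 Q; nra.
have hB : 2 * B / r <= 1 by rewrite ler_pdivrMr; lra.
have := Im_inv_near_2i (le_trans NvQ hB).
have -> : complex.Im ((0 +i* 2)%C + v * Q)^-1 =
    - \int[nu]_t ((x - t) ^+ 2 + 1)^-1.
  rewrite -Fnu /rcauchy_transform invrK; congr (- _).
  by apply: eq_Rintegral => t _ /=; rewrite expr1n div1r.
rewrite opprK; lra.
Qed.

(** * From Poisson integrals to masses of intervals and the Lévy distance *)

Section levy.
Variables (R : realType) (nu : probability R R).
Implicit Types (p q r x t : R).

Let P (A : set R) : R := fine (nu A).

Let PD (A B : set R) : measurable A -> measurable B -> [disjoint A & B] ->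
  P (A `|` B) = P A + P B.
Proof.
move=> mA mB /disj_set2P AB; rewrite /P measureU//.
by rewrite fineD//; exact: fin_num_measure.
Qed.

Let Ple (A B : set R) : measurable A -> measurable B -> A `<=` B -> P A <= P B.
Proof.
move=> mA mB AB; apply: fine_le; rewrite ?fin_num_measure//.
by apply: le_measure; rewrite ?inE.
Qed.

Let PT : P setT = 1.
Proof. exact: (congr1 fine (probability_setT nu)). Qed.

Lemma integrable_cauchy_im p : nu.-integrable setT (fun t => (cauchy_im p t)%:E).
Proof.
have := integrable_mul_bounded (@measurable_cauchy_im _ p) (cauchy_im_le1 p)
  (finite_measure_integrable_cst nu 1 measurableT).
by apply: eq_integrable => // t _; rewrite /= mul1r.
Qed.

Lemma cauchy_im_le_inv p t r : 1 <= r -> r <= `|p - t| -> cauchy_im p t <= r^-1.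
Proof.
move=> r1 rp; have r0 : 0 < r by lra.
rewrite /cauchy_im lef_pV2 ?posrE ?cauchy_denom_gt0//.
by rewrite -[(p - t) ^+ 2]real_normK ?num_real//; nra.
Qed.

(* Off [p - 1, p + 1] the kernel at [p] is at most 1 / 2, and everywhere at
   least one of the two kernels is at most 1 / r; hence
   3 cauchy_im p + 2 cauchy_im q <= \1_[p - 1, p + 1] + 2 + 3 / r. *)
Lemma mass_near_ge p q r : 1 <= r -> 2 * r <= `|p - q| ->
  3 * (\int[nu]_t cauchy_im p t) + 2 * (\int[nu]_t cauchy_im q t)
    - 2 - 3 / r <= P `[p - 1, p + 1].
Proof.
move=> r1 rpq; set A := [set` _].
have mA : measurable A by exact: measurable_itv.
have ip := integrable_cauchy_im p; have iq := integrable_cauchy_im q.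
have i3p := integrableZl measurableT 3 ip; have i2q := integrableZl measurableT 2 iq.
have iA : nu.-integrable setT (EFin \o \1_A) by exact: integrable_indic.
have ic := finite_measure_integrable_cst nu (2 + 3 / r) measurableT.
have -> : P A = \int[nu]_t \1_A t by rewrite /Rintegral integral_indic// setIT.
have E : \int[nu]_t (2 + 3 / r) = 2 + 3 / r.
  by rewrite Rintegral_cst// -/(P setT) PT mulr1.
rewrite -!RintegralZl// -RintegralD//.
suff : \int[nu]_t (3 * cauchy_im p t + 2 * cauchy_im q t) <=
    \int[nu]_t (\1_A t + (2 + 3 / r))
  by rewrite (RintegralD measurableT iA ic) E; lra.
apply: le_Rintegral => //; [exact: (integrableD measurableT i3p i2q)|
  exact: (integrableD measurableT iA ic)|move=> t _].
have r0 : 0 < r^-1 by rewrite invr_gt0; lra.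
have fp := le_trans (ler_norm _) (cauchy_im_le1 p t).
have fq := le_trans (ler_norm _) (cauchy_im_le1 q t).
have hp := @cauchy_im_le_inv p t _ r1; have hq := @cauchy_im_le_inv q t _ r1.
have tri : `|p - q| <= `|p - t| + `|q - t|.
  by rewrite (distrC q t); apply: le_trans (ler_normD _ _); rewrite addrA subrK.
(* Inside [A] the left side is at most [3 + 2 / r]. Outside it is at most [3 / r + 2] if [t] is far
   from [p], and [3 / 2 + 2 / r] otherwise. *)
rewrite indicE; case: (boolP (t \in A)); rewrite /A mem_setE in_itv /=.
  move=> /andP[t1 t2]; have : `|p - t| <= 1 by rewrite ler_norml; lra.
  by move=> ?; have := hq ltac:(lra); lra.
move=> tA; have hp1 : cauchy_im p t <= 1 / 2.
  rewrite /cauchy_im div1r lef_pV2 ?posrE ?cauchy_denom_gt0//.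
  move: tA; rewrite negb_and -!ltNge => /orP[] ?; nra.
have [hpt|hpt] := leP r `|p - t|; first by have := hp hpt; lra.
by have := hq ltac:(lra); lra.
Qed.

Lemma distr_fun_dilate r x : 0 < r ->
  distr_fun (dilate r^-1 nu) x = P `]-oo, r * x].
Proof.
move=> r0; rewrite /distr_fun /dilate; congr (fine (nu _)).
by apply/seteqP; split => t /=; rewrite in_itv /= ler_pdivrMl.
Qed.

Lemma distr_fun_bernoulli_sym x :
  distr_fun (@bernoulli_sym R) x = ((-1 <= x)%R%:R + (1 <= x)%R%:R) / 2.
Proof.
have E a : (a \in [set t | t <= x]) = (a <= x) by apply/idP/idP; rewrite inE.
by rewrite /distr_fun /bernoulli_sym !diracE !E /= [RHS]mulrC mulrDr.
Qed.

Lemma cdf_ge p x : p + 1 <= x -> P `[p - 1, p + 1] <= P `]-oo, x].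
Proof.
move=> px; apply: Ple => // t /=; rewrite !in_itv /= => /andP[_ ?]; lra.
Qed.

Lemma cdf_le p x : x < p - 1 -> P `]-oo, x] <= 1 - P `[p - 1, p + 1].
Proof.
move=> px; rewrite lerBrDr -[leRHS]PT -PD//.
  by apply: Ple => //; exact: measurableU.
by apply/disj_setPS => t []/=; rewrite !in_itv /= => ? /andP[? _]; exfalso; lra.
Qed.

(** Both unit neighbourhoods lie within [K] of [- r] and [r], so shifting [r * x] by [K] steps over
    the relevant one. For [x] outside [[-1, 1[] the masses of both intervals are used, losing
    [2 * e]; for [x] inside, each inequality uses one of them and loses [e]. *)
Lemma levy_dist_bernoulli_le p q r K e : 0 < r -> 0 < K -> p + 1 < q - 1 ->
  - r - K <= p - 1 -> p + 1 <= - r + K -> r - K <= q - 1 -> q + 1 <= r + K ->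
  1 / 2 - e <= P `[p - 1, p + 1] -> 1 / 2 - e <= P `[q - 1, q + 1] ->
  2 * e <= K / r ->
  levy_dist (dilate r^-1 nu) (@bernoulli_sym R) <= K / r.
Proof.
move=> r0 K0 pq p1 p2 q1 q2 hp hq eK.
have Kr0 : 0 < K / r by rewrite divr_gt0.
have e0 : 0 <= K / r - e by lra.
(* The admissible [eps] are bounded below by 0, so it suffices that [K / r] is admissible. *)
apply: ge_inf; first by exists 0 => y [/ltW].
split=> // x; rewrite !distr_fun_dilate// distr_fun_bernoulli_sym.
have -> : r * (x - K / r) = r * x - K by field; rewrite gt_eqF.
have -> : r * (x + K / r) = r * x + K by field; rewrite gt_eqF.
have mI (a b : R) : measurable `[a, b]%classic by exact: measurable_itv.
have dPQ : [disjoint `[p - 1, p + 1]%classic & `[q - 1, q + 1]%classic].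
  apply/disj_setPS => t []/=; rewrite !in_itv /= => /andP[_ ?] /andP[? _].
  by exfalso; lra.
have PQ := PD (mI _ _) (mI _ _) dPQ.
have P0 a : 0 <= P `]-oo, a] by exact: fine_ge0.
have P1 a : P `]-oo, a] <= 1 by rewrite -[leRHS]PT; exact: Ple.
have [x1|x1] := ltP x (-1).
  have -> : (1 <= x) = false by apply/negbTE; rewrite -ltNge; lra.
  rewrite addr0 mul0r; split; last by have := P0 (r * x + K); lra.
  suff : P `]-oo, r * x - K] + (P `[p - 1, p + 1] + P `[q - 1, q + 1]) <= 1 by lra.
  rewrite -PQ -[leRHS]PT -PD//.
    by apply: Ple => //; do 2 apply: measurableU => //.
    exact: measurableU.
  apply/disj_setPS => t []/=; rewrite !in_itv /= => ? []/andP[? _]; exfalso; nra.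
have [x2|x2] := ltP x 1.
  rewrite addr0 div1r; split.
    have /cdf_le : r * x - K < q - 1 by nra.
    lra.
  have /cdf_ge : p + 1 <= r * x + K by nra.
  lra.
have -> : (true%:R + true%:R) / 2 = 1 :> R by rewrite /=; lra.
split; first by have := P1 (r * x - K); lra.
suff : P `[p - 1, p + 1] + P `[q - 1, q + 1] <= P `]-oo, r * x + K] by lra.
rewrite -PQ; apply: Ple => //; first exact: measurableU.
by move=> t []/=; rewrite !in_itv /= => /andP[_ ?]; nra.
Qed.

End levy.

(** * The convergence rate in the Lévy distance *)

Theorem theorem1 (R : realType) (mu : probability R R) :
  mu.-integrable setT (fun t : R => (t ^+ 6)%:E) ->
  (\int[mu]_t (t%:E) = 0)%E ->
  (\int[mu]_t ((t ^+ 2)%:E) = 1)%E ->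
  exists C : R, exists N : nat, forall n : nat, (N <= n)%N ->
    forall nu : probability R R, boolean_pow mu n nu ->
      levy_dist (dilate (Num.sqrt (n%:R))^-1 nu) (@bernoulli_sym R)
        <= 7 / 2 * ((C + 2) / Num.sqrt (n%:R)).
Proof.
move=> i6 m1 m2.
have [||c [c0 [r0 hc]]] := poisson_integral_boolean_pow_ge
  (integrable_lower_moment (isT : (5 <= 6)%N) i6).
- by rewrite /moment /Rintegral (_ : \int[mu]_t (t ^+ 1)%:E = 0)%E.
- by rewrite /moment /Rintegral m2.
set m3 := moment mu 3 in hc.
(* With [K = 7 / 2 * (C + 2)], the term [|m3|] absorbs the shift [m3 / 2] of the centres, and
   [10 * c + 6] is twice the mass loss [5 * c + 3] found below. *)
exists (`|m3| + 10 * c + 6).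
(* This forces [r >= |r0| + 2]; the extra 2 gives [r > 1], which separates the two intervals. *)
exists (Num.bound ((`|r0| + 2) ^+ 2)) => n hn nu pow.
set r := Num.sqrt n%:R.
have rn : r ^+ 2 = n%:R by rewrite sqr_sqrtr// ler0n.
have r_ge : `|r0| + 2 <= r.
  rewrite -(ler_pXn2r (ltn0Sn 1)) ?nnegrE ?addr_ge0 ?sqrtr_ge0// rn.
  apply: ltW; apply: lt_le_trans (archi_boundP (sqr_ge0 _)) _.
  by rewrite ler_nat.
have := ler_norm r0; have := normr_ge0 r0 => r00 r0n.
have hp := hc n r r nu pow ltac:(lra) rn (or_introl erefl).
have hq := hc n r (- r) nu pow ltac:(lra) rn (or_intror erefl).
have [m3l m3u] : - `|m3| <= m3 /\ m3 <= `|m3|.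
  by have := lerNnormlW (lexx `|m3|); have := ler_norm m3.
have near p q : `|p - q| = 2 * r ->
    1 / 2 - c / r <= \int[nu]_t cauchy_im p t ->
    1 / 2 - c / r <= \int[nu]_t cauchy_im q t ->
    (* The weights 3 and 2 turn the two bounds into [5 / 2 - 5 * c / r], from which [2 + 3 / r] is
       subtracted. *)
    1 / 2 - (5 * c + 3) / r <= fine (nu `[p - 1, p + 1]%classic).
  move=> pq kp kq; have := @mass_near_ge _ nu p q r ltac:(lra).
  rewrite pq lexx => /(_ isT); apply: le_trans.
  by rewrite mulrDl -mulrA; lra.
have r2 : `|2 * r| = 2 * r by rewrite ger0_norm//; lra.
rewrite mulrA; apply: (@levy_dist_bernoulli_le _ _ (- r + m3 / 2) (r + m3 / 2) r _
  ((5 * c + 3) / r)); try lra.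
- by apply: near hq hp; rewrite -r2 -normrN; congr `|_|; lra.
- by apply: near hp hq; rewrite -r2; congr `|_|; lra.
- by rewrite mulrA ler_pM2r ?invr_gt0; lra.
Qed.
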